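(* Let $\mathcal{I}(\mathcal{D},\mathcal{P},\mathcal{A})$ be a two-sender unicast index coding problem with an eavesdropper such that weakly secure linear index codes exist for the single-sender problems $\mathcal{I}(\mathcal{D}_{\mathcal{T}},\mathcal{A}_{\mathcal{T}})$ for all non-empty $\mathcal{T}\subseteq\{1,2\}$, and let $\mathcal{C}_{\mathcal{T}}$ be an optimal (length $l^*_{\mathcal{T}}$) weakly secure linear code for $\mathcal{I}(\mathcal{D}_{\mathcal{T}},\mathcal{A}_{\mathcal{T}})$. Suppose one of the following holds, and consider the corresponding constructed two-sender code $\mathcal{C}$: (II-B) the interactions $\mathcal{D}_i\rightarrow\mathcal{D}_{\{1,2\}}$ and $\mathcal{D}_{\{1,2\}}\rightarrow\mathcal{D}_i$ exist and are fully-participated for both $i\in\{1,2\}$. Code: if $l^*_{\{1,2\}}\ge l^*_1+l^*_2$ or $l^*_{\{1,2\}}\ge\max\{l^*_1,l^*_2\}$, $\mathcal{S}_1$ sends $\mathcal{C}_1+\mathcal{C}_{\{1,2\}}[1:l^*_1]$ and $\mathcal{S}_2$ sends $\mathcal{C}_2+\mathcal{C}_{\{1,2\}}[l^*_1+1:l^*_{\{1,2\}}]$; if $l^*_{\{1,2\}}\le l^*_1$, $\mathcal{S}_1$ sends $\mathcal{C}_1+\mathcal{C}_{\{1,2\}}$ and $\mathcal{S}_2$ sends $\mathcal{C}_2$; if $l^*_{\{1,2\}}\le l^*_2$, $\mathcal{S}_2$ sends $\mathcal{C}_2+\mathcal{C}_{\{1,2\}}$ and $\mathcal{S}_1$ sends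 $\mathcal{C}_1$. (II-C) the interactions $\mathcal{D}_1\rightarrow\mathcal{D}_{\{1,2\}}$ and $\mathcal{D}_{\{1,2\}}\rightarrow\mathcal{D}_1$ exist and are fully-participated, and $\mathcal{D}_2\rightarrow\mathcal{D}_{\{1,2\}}$, $\mathcal{D}_{\{1,2\}}\rightarrow\mathcal{D}_2$ do not both exist. Code: $\mathcal{S}_1$ sends $\mathcal{C}_1+\mathcal{C}_{\{1,2\}}$, $\mathcal{S}_2$ sends $\mathcal{C}_2$. (II-D) the interactions $\mathcal{D}_2\rightarrow\mathcal{D}_{\{1,2\}}$ and $\mathcal{D}_{\{1,2\}}\rightarrow\mathcal{D}_2$ exist and are fully-participated, and $\mathcal{D}_1\rightarrow\mathcal{D}_{\{1,2\}}$, $\mathcal{D}_{\{1,2\}}\rightarrow\mathcal{D}_1$ do not both exist. Code: $\mathcal{S}_2$ sends $\mathcal{C}_2+\mathcal{C}_{\{1,2\}}$, $\mathcal{S}_1$ sends $\mathcal{C}_1$. (II-E) all existing interactions are fully-participated, the interaction digraph $\mathcal{H}$ contains a directed cycle of length 3, and for neither $i\in\{1,2\}$ do both edges $(i,\{1,2\})$, $(\{1,2\},i)$ belong to $\mathcal{H}$. Code: if $l^*_1\le\min\{l^*_2,l^*_{\{1,2\}}\}$, $\mathcal{S}_1$ sends $\mathcal{C}_1+\mathcal{C}_{\{1,2\}}[1:l^*_1]$, $\mathcal{S}_2$ sends $\mathcal{C}_2+\mathcal{C}_{\{1,2\}}[1:l^*_1]$, and $\mathcal{S}_1$ or $\mathcal{S}_2$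 sends $\mathcal{C}_{\{1,2\}}[l^*_1+1:l^*_{\{1,2\}}]$; if $l^*_2\le\min\{l^*_1,l^*_{\{1,2\}}\}$, $\mathcal{S}_1$ sends $\mathcal{C}_1+\mathcal{C}_{\{1,2\}}[1:l^*_2]$, $\mathcal{S}_2$ sends $\mathcal{C}_2+\mathcal{C}_{\{1,2\}}[1:l^*_2]$, and $\mathcal{S}_1$ or $\mathcal{S}_2$ sends $\mathcal{C}_{\{1,2\}}[l^*_2+1:l^*_{\{1,2\}}]$; otherwise $\mathcal{S}_1$ sends $\mathcal{C}_1+\mathcal{C}_{\{1,2\}}$ and $\mathcal{S}_2$ sends $\mathcal{C}_2+\mathcal{C}_{\{1,2\}}$. Suppose in addition that the eavesdropper knows every message in $\mathcal{P}_{\{1,2\}}$ (i.e. $x_{\mathcal{A}_{\{1,2\}}}=\mathcal{P}_{\{1,2\}}$). If $l^*(\mathcal{I}(\mathcal{D},\mathcal{P},\mathcal{A}))\le l^*_1+l^*_2$, then the constructed code $\mathcal{C}$ is optimal, i.e. it is a weakly secure linear two-sender index code for $\mathcal{I}(\mathcal{D},\mathcal{P},\mathcal{A})$ of length $l^*(\mathcal{I}(\mathcal{D},\mathcal{P},\mathcal{A}))$.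
   Context: Fix a finite field $\mathbb{F}_q$ and messages $\mathcal{M}=\{x_1,\dots,x_m\}$, $x_i\in\mathbb{F}_q$; $x_i$ is a realization of a random variable $X_i$, and the $X_i$ are independent and uniform on $\mathbb{F}_q$. There are $m$ receivers; receiver $i$ demands $x_i$ and has side-information $\mathcal{K}_i\subseteq\mathcal{M}\setminus\{x_i\}$. The side-information digraph $\mathcal{D}$ has vertices $v_1,\dots,v_m$ and an edge $(v_i,v_j)$ iff $x_j\in\mathcal{K}_i$. For $\mathcal{B}\subseteq[m]=\{1,\dots,m\}$ put $x_{\mathcal{B}}=\{x_i:i\in\mathcal{B}\}$. Single-sender problem $\mathcal{I}(\mathcal{D},\mathcal{A})$: one sender knows all messages and transmits $\mathbf{G}\mathbf{x}$, $\mathbf{G}\in\mathbb{F}_q^{l\times m}$, $\mathbf{x}=(x_1,\dots,x_m)^T$; this is a linear index code of length $l$ if every receiver $i$ can recover $x_i$ from $\mathbf{G}\mathbf{x}$ and $\mathcal{K}_i$. An eavesdropper knows $x_{\mathcal{A}}$ and $\mathbf{G}\mathbf{x}$. The code is weakly secure if $H(X_i\mid\mathbf{G}\mathbf{X},X_{\mathcal{A}})=H(X_i)$ for every message index $i\notin\mathcal{A}$. Two-sender problem $\mathcal{I}(\mathcal{D},\mathcal{P},\mathcal{A})$: sender $\mathcal{S}_j$ knows $\mathcal{M}_j\subseteq\mathcal{M}$, $j\in\{1,2\}$, with $\mathcal{M}_1\cup\mathcal{M}_2=\mathcal{M}$. Put $\mathcal{P}_1=\mathcal{M}_1\setminus\mathcal{M}_2$,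 $\mathcal{P}_2=\mathcal{M}_2\setminus\mathcal{M}_1$, $\mathcal{P}_{\{1,2\}}=\mathcal{M}_1\cap\mathcal{M}_2$, $\mathcal{P}=(\mathcal{P}_1,\mathcal{P}_2,\mathcal{P}_{\{1,2\}})$. Singletons are written without braces: the non-empty $\mathcal{T}\subseteq\{1,2\}$ are $1,2,\{1,2\}$. A linear two-sender index code consists of linear codewords $\mathbf{c}_1,\mathbf{c}_2$ over $\mathbb{F}_q$ of lengths $l_1,l_2$, where $\mathbf{c}_j$ (everything sent by $\mathcal{S}_j$) is a linear function of the messages in $\mathcal{M}_j$ only, such that each receiver $i$ can recover $x_i$ from $\mathbf{c}_1,\mathbf{c}_2,\mathcal{K}_i$. Its length is $l_1+l_2$. An eavesdropper knows $x_{\mathcal{A}}$, $\mathcal{A}\subsetneq[m]$, and $\mathbf{c}_1,\mathbf{c}_2$; the code is weakly secure if $H(X_i\mid\mathbf{c}_1,\mathbf{c}_2,X_{\mathcal{A}})=H(X_i)$ for all $i\in[m]\setminus\mathcal{A}$. For non-empty $\mathcal{T}\subseteq\{1,2\}$, $\mathcal{D}_{\mathcal{T}}$ is the sub-digraph of $\mathcal{D}$ induced by $\{v_j:x_j\in\mathcal{P}_{\mathcal{T}}\}$ (the problem with messages and receivers restricted to $\mathcal{P}_{\mathcal{T}}$, side-information $\mathcal{K}_i\cap\mathcal{P}_{\mathcal{T}}$), and $\mathcal{A}_{\mathcal{T}}$ is the set of $i\in\mathcal{A}$ with $x_i\in\mathcal{P}_{\mathcal{T}}$. $l^*(\cdot)$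 denotes the minimum length over $\mathbb{F}_q$ of a weakly secure linear index code for the given problem, and $l^*_{\mathcal{T}}=l^*(\mathcal{I}(\mathcal{D}_{\mathcal{T}},\mathcal{A}_{\mathcal{T}}))$. For $\mathcal{T}\ne\mathcal{T}'$, the interaction $\mathcal{D}_{\mathcal{T}}\rightarrow\mathcal{D}_{\mathcal{T}'}$ exists if $\mathcal{D}$ has an edge from some vertex of $\mathcal{D}_{\mathcal{T}}$ to some vertex of $\mathcal{D}_{\mathcal{T}'}$; it is fully-participated if there are edges from every vertex of $\mathcal{D}_{\mathcal{T}}$ to every vertex of $\mathcal{D}_{\mathcal{T}'}$. The interaction digraph $\mathcal{H}$ has vertex set $\{1,2,\{1,2\}\}$ and an edge $(\mathcal{T},\mathcal{T}')$ iff the interaction $\mathcal{D}_{\mathcal{T}}\rightarrow\mathcal{D}_{\mathcal{T}'}$ exists. For two codewords, $\mathbf{c}+\mathbf{c}'$ denotes symbol-wise addition after appending zeros at the end of the shorter one to match the length of the longer one; $\mathbf{c}[a:b]$ is the vector of code symbols of $\mathbf{c}$ in coordinates $a$ through $b$ (empty if $a>b$). *)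

(* Defs.v *)
From HB Require Import structures.
From mathcomp Require Import all_boot all_order all_algebra.
From mathcomp Require Import reals exp.

Set Implicit Arguments.
Unset Strict Implicit.
Unset Printing Implicit Defensive.

Import Order.TTheory GRing.Theory Num.Theory.
Local Open Scope ring_scope.

Section Entropy.
Variables (R : realType) (Omega : finType) (P : Omega -> R).

Definition pr (E : pred Omega) : R := \sum_(w | E w) P w.

(* Entropies are in nats. The convention 0 log 0 = 0 is automatic: a vanishing
   probability makes the factor in front of [ln] zero. *)
Definition entropy (S : finType) (X : Omega -> S) : R :=
  - \sum_(s : S) pr [pred w | X w == s] * ln (pr [pred w | X w == s]).

Definition cond_entropy (S U : finType) (X : Omega -> S) (Y : Omega -> U) : R :=
  - \sum_(u : U) \sum_(s : S)
      pr [pred w | (X w == s) && (Y w == u)] *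
      ln (pr [pred w | (X w == s) && (Y w == u)] / pr [pred w | Y w == u]).

End Entropy.

Section Problems.
Variables (R : realType) (F : finFieldType).

(* A realisation of the n messages is a column vector x; its components are
   the values of independent random variables, each uniform on F. *)
Definition msg_pmf (n : nat) (x : 'cV[F]_n) : R :=
  \prod_(i < n) (#|F|%:R)^-1.

(* x_B, the subvector of the messages with index in B, in increasing order *)
Definition restr (n : nat) (B : {set 'I_n}) (x : 'cV[F]_n) : 'cV[F]_#|B| :=
  \col_(k < #|B|) x (enum_val k) 0.

(* In the next two definitions [c x] is everything that is transmitted when the
   messages are x. The side-information digraph is given by its
   out-neighbourhoods: the edge (i, j) is present iff j \in K i. *)
Definition decodable (n : nat) (K : 'I_n -> {set 'I_n})
    (T : finType) (c : 'cV[F]_n -> T) : Prop :=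
  forall i : 'I_n, exists dec : T -> 'cV[F]_#|K i| -> F,
    forall x : 'cV[F]_n, dec (c x) (restr (K i) x) = x i 0.

Definition weakly_secure (n : nat) (A : {set 'I_n})
    (T : finType) (c : 'cV[F]_n -> T) : Prop :=
  forall i : 'I_n, i \notin A ->
    cond_entropy (@msg_pmf n) (fun x => x i 0) (fun x => (c x, restr A x))
    = entropy (@msg_pmf n) (fun x => x i 0).

Definition is_min (Q : nat -> Prop) (l : nat) : Prop :=
  Q l /\ forall l' : nat, Q l' -> (l <= l')%N.

Definition secure_code (n : nat) (K : 'I_n -> {set 'I_n}) (A : {set 'I_n})
    (l : nat) (G : 'M[F]_(l, n)) : Prop :=
  decodable K (fun x => G *m x) /\ weakly_secure A (fun x => G *m x).

(* [opt_length K A l] states that l is l^*(I(D, A)). *)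
Definition opt_length (n : nat) (K : 'I_n -> {set 'I_n}) (A : {set 'I_n})
    (l : nat) : Prop :=
  is_min (fun l' => exists G : 'M[F]_(l', n), secure_code K A G) l.

Record code2 (m : nat) := Code2 {
  len1 : nat;
  len2 : nat;
  cw1 : 'cV[F]_m -> 'cV[F]_len1;
  cw2 : 'cV[F]_m -> 'cV[F]_len2 }.

Definition length2 (m : nat) (c : code2 m) : nat := (len1 c + len2 c)%N.

Definition linear_in (m : nat) (M : {set 'I_m}) (l : nat)
    (c : 'cV[F]_m -> 'cV[F]_l) : Prop :=
  exists G : 'M[F]_(l, #|M|), forall x, c x = G *m restr M x.

Definition secure_code2 (m : nat) (K : 'I_m -> {set 'I_m})
    (M1 M2 A : {set 'I_m}) (c : code2 m) : Prop :=
  [/\ linear_in M1 (@cw1 m c), linear_in M2 (@cw2 m c),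
      decodable K (fun x => (cw1 c x, cw2 c x))
    & weakly_secure A (fun x => (cw1 c x, cw2 c x))].

(* [opt_length2 K M1 M2 A l] states that l is l^*(I(D, P, A)); it holds for no
   l when there is no weakly secure two-sender linear code. *)
Definition opt_length2 (m : nat) (K : 'I_m -> {set 'I_m})
    (M1 M2 A : {set 'I_m}) (l : nat) : Prop :=
  is_min (fun l' => exists c : code2 m,
    secure_code2 K M1 M2 A c /\ length2 c = l') l.

(* [sym c k] is the symbol of c in the 0-based coordinate k, and 0 past the
   end. *)
Definition sym (l : nat) (c : 'cV[F]_l) (k : nat) : F :=
  if insub k is Some i then c i 0 else 0.

Definition addcw (a b : nat) (c : 'cV[F]_a) (c' : 'cV[F]_b)
    : 'cV[F]_(maxn a b) :=
  \col_k (sym c k + sym c' k).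

(* c[a:b], where coordinates are counted from 1 *)
Definition slice (l : nat) (c : 'cV[F]_l) (a b : nat) : 'cV[F]_(b.+1 - a) :=
  \col_k sym c (a.-1 + k).

End Problems.

(* The induced problem on the messages in B, relabelled by 'I_#|B| along
   the increasing enumeration of B. *)
Definition sub_set (m : nat) (B A : {set 'I_m}) : {set 'I_#|B|} :=
  [set k : 'I_#|B| | enum_val k \in A].

Arguments sub_set {m} B A.

Definition sub_side (m : nat) (B : {set 'I_m}) (K : 'I_m -> {set 'I_m})
    : 'I_#|B| -> {set 'I_#|B|} :=
  fun k => sub_set B (K (enum_val k)).

Arguments sub_side {m} B K k.

(* The non-empty subsets {1}, {2} and {1,2} of the set of senders *)
Inductive senders : Set := S1 | S2 | S12.

Definition part (m : nat) (M1 M2 : {set 'I_m}) (T : senders) : {set 'I_m} :=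
  match T with
  | S1 => M1 :\: M2
  | S2 => M2 :\: M1
  | S12 => M1 :&: M2
  end.

Section Construction.
Variables (F : finFieldType) (m : nat) (K : 'I_m -> {set 'I_m}).
Variables (M1 M2 : {set 'I_m}).

Local Notation P := (part M1 M2).

Definition interaction (T T' : senders) : Prop :=
  exists i j : 'I_m, [/\ i \in P T, j \in P T' & j \in K i].

Definition fully_participated (T T' : senders) : Prop :=
  forall i j : 'I_m, i \in P T -> j \in P T' -> j \in K i.

(* edges of the interaction digraph *)
Definition Hedge (T T' : senders) : Prop := T <> T' /\ interaction T T'.

Definition both_full (T : senders) : Prop :=
  [/\ interaction T S12, fully_participated T S12,
      interaction S12 T & fully_participated S12 T].

Definition case_B : Prop := both_full S1 /\ both_full S2.

Definition case_C : Prop :=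
  both_full S1 /\ ~ (interaction S2 S12 /\ interaction S12 S2).

Definition case_D : Prop :=
  both_full S2 /\ ~ (interaction S1 S12 /\ interaction S12 S1).

Definition case_E : Prop :=
  [/\ forall T T', T <> T' -> interaction T T' -> fully_participated T T',
      exists T T' T'', [/\ T <> T', T' <> T'', T <> T''
                         & [/\ Hedge T T', Hedge T' T'' & Hedge T'' T]],
      ~ (Hedge S1 S12 /\ Hedge S12 S1)
    & ~ (Hedge S2 S12 /\ Hedge S12 S2)].

Variables (l : senders -> nat) (C : forall T, 'M[F]_(l T, #|P T|)).

Let l1 := l S1.
Let l2 := l S2.
Let l12 := l S12.

Let c1 (x : 'cV[F]_m) : 'cV[F]_l1 := C S1 *m restr (P S1) x.
Let c2 (x : 'cV[F]_m) : 'cV[F]_l2 := C S2 *m restr (P S2) x.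
Let c12 (x : 'cV[F]_m) : 'cV[F]_l12 := C S12 *m restr (P S12) x.

(* Where the length conditions overlap, every applicable construction counts;
   in case E the leftover symbols may be sent by either sender. *)
Inductive constructed : code2 F m -> Prop :=
| built_B_long of case_B & (l1 + l2 <= l12)%N \/ (maxn l1 l2 <= l12)%N :
    constructed (Code2 (fun x => addcw (c1 x) (slice (c12 x) 1 l1))
                       (fun x => addcw (c2 x) (slice (c12 x) l1.+1 l12)))
| built_B_1 of case_B & (l12 <= l1)%N :
    constructed (Code2 (fun x => addcw (c1 x) (c12 x)) c2)
| built_B_2 of case_B & (l12 <= l2)%N :
    constructed (Code2 c1 (fun x => addcw (c2 x) (c12 x)))
| built_C of case_C :
    constructed (Code2 (fun x => addcw (c1 x) (c12 x)) c2)
| built_D of case_D :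
    constructed (Code2 c1 (fun x => addcw (c2 x) (c12 x)))
| built_E_1_by1 of case_E & (l1 <= minn l2 l12)%N :
    constructed (Code2 (fun x => col_mx (addcw (c1 x) (slice (c12 x) 1 l1))
                                        (slice (c12 x) l1.+1 l12))
                       (fun x => addcw (c2 x) (slice (c12 x) 1 l1)))
| built_E_1_by2 of case_E & (l1 <= minn l2 l12)%N :
    constructed (Code2 (fun x => addcw (c1 x) (slice (c12 x) 1 l1))
                       (fun x => col_mx (addcw (c2 x) (slice (c12 x) 1 l1))
                                        (slice (c12 x) l1.+1 l12)))
| built_E_2_by1 of case_E & (l2 <= minn l1 l12)%N :
    constructed (Code2 (fun x => col_mx (addcw (c1 x) (slice (c12 x) 1 l2))
                                        (slice (c12 x) l2.+1 l12))
                       (fun x => addcw (c2 x) (slice (c12 x) 1 l2)))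
| built_E_2_by2 of case_E & (l2 <= minn l1 l12)%N :
    constructed (Code2 (fun x => addcw (c1 x) (slice (c12 x) 1 l2))
                       (fun x => col_mx (addcw (c2 x) (slice (c12 x) 1 l2))
                                        (slice (c12 x) l2.+1 l12)))
| built_E_else of case_E & ~ (l1 <= minn l2 l12)%N & ~ (l2 <= minn l1 l12)%N :
    constructed (Code2 (fun x => addcw (c1 x) (c12 x))
                       (fun x => addcw (c2 x) (c12 x))).

End Construction.

(* Main.v *)
(* A weakly secure linear code is one in which, for every i outside A, some
   message vector with x_A = 0 and x_i <> 0 is invisible in the codeword:
   adding its multiples makes X_i uniform given all that the eavesdropper sees.

   Lower bound: setting the other messages to zero turns a two-sender code into
   a code for each D_T. Since the private messages P_1 reach the first codeword
   only (and likewise for P_2), and the eavesdropper knows P_{1,2}, the two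
   codeword lengths are at least l_1 and l_2; hence lstar = l_1 + l_2, and also
   l_{1,2} <= lstar. If D_T -> D_T' does not exist, the receivers in D_T must
   decode after the interference of P_T', which spans a space of dimension at
   least l_T', has been projected away; hence l_T + l_T' <= lstar. These bounds
   give l_{1,2} <= l_1 in case II-C, l_{1,2} <= l_2 in case II-D and both in
   case II-E, which is what makes the constructed length equal to l_1 + l_2. *)

Require Import Defs.
From HB Require Import structures.
From mathcomp Require Import all_boot all_order all_algebra.
From mathcomp Require Import reals exp zify.

Import Order.TTheory GRing.Theory Num.Theory.
Local Open Scope ring_scope.
Set Implicit Arguments.
Unset Strict Implicit.
Unset Printing Implicit Defensive.

(** * Weak security in terms of invisible message vectors *)

Section Security.
Variables (R : realType) (F : finFieldType) (n : nat).
Implicit Types (U : finType) (i : 'I_n).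

Local Notation pmf := (@msg_pmf R F n).

(* The fibres of Y are the cosets of a linear subspace. Phrasing this without a
   linear structure on U lets codewords be paired with side information. *)
Definition periodic U (Y : 'cV[F]_n -> U) :=
  (forall a x y, Y x = Y 0 -> Y (y + a *: x) = Y y) /\
  (forall x y, Y x = Y y -> Y (x - y) = Y 0).

Lemma periodic_pair U (V : finType) (Y : 'cV[F]_n -> U) (Z : 'cV[F]_n -> V) :
  periodic Y -> periodic Z -> periodic (fun x => (Y x, Z x)).
Proof.
move=> [Y1 Y2] [Z1 Z2]; split.
  by move=> a x y [? ?]; rewrite Y1 ?Z1.
by move=> x y [? ?]; rewrite Y2 ?Z2.
Qed.

Lemma periodic_mulmx l (G : 'M[F]_(l, n)) : periodic (fun x => G *m x).
Proof.
split=> [a x y|x y e]; last by rewrite mulmxBr e subrr mulmx0.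
by rewrite mulmx0 mulmxDr -scalemxAr => ->; rewrite scaler0 addr0.
Qed.

Lemma periodic_const : periodic (fun _ => tt).
Proof. by []. Qed.

Lemma periodic_restr (A : {set 'I_n}) : periodic (@restr F n A).
Proof.
split=> [a x y e|x y e]; apply/colP=> k; move/colP/(_ k): e; rewrite !mxE.
  by move=> ->; rewrite mulr0 addr0.
by move=> ->; rewrite subrr.
Qed.

Lemma pmf_sum : \sum_x pmf x = 1.
Proof.
rewrite sumr_const card_mx muln1 /msg_pmf prodr_const card_ord -[LHS]mulr_natl.
by rewrite natrX -exprMn divff ?expr1n // pnatr_eq0 -lt0n (ltn_trans _ (card_finNzRing_gt1 F)).
Qed.

Lemma pr_partition (S : finType) (X : 'cV[F]_n -> S) (E : pred 'cV[F]_n) :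
  pr pmf E = \sum_s pr pmf [pred w : 'cV[F]_n | (X w == s) && E w].
Proof.
rewrite /pr (partition_big X predT) //=; apply: eq_bigr => s _.
by apply: eq_bigl => w; rewrite /= andbC.
Qed.

Section Masked.
Variables (U : finType) (Y : 'cV[F]_n -> U) (i : 'I_n) (z : 'cV[F]_n).
Hypotheses (HY : periodic Y) (Yz : Y z = Y 0) (zi : z i 0 != 0).

(** Translation by a multiple of [z] permutes the message vectors, preserves the uniform
    distribution and the value of [Y], and shifts coordinate [i] by any prescribed amount. *)
Lemma pr_masked u s t :
  pr pmf [pred w : 'cV[F]_n | (w i 0 == s) && (Y w == u)] =
  pr pmf [pred w : 'cV[F]_n | (w i 0 == t) && (Y w == u)].
Proof.
set v := ((s - t) / z i 0) *: z.
rewrite {1}/pr (reindex_inj (addIr v)); apply: eq_bigl => w /=.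
by rewrite HY.1 // !mxE divfK // -subr_eq0 -addrA [s - t - s]addrAC subrr sub0r subr_eq0.
Qed.

Lemma pr_marginal u s :
  pr pmf [pred w : 'cV[F]_n | Y w == u] =
  #|F|%:R * pr pmf [pred w : 'cV[F]_n | (w i 0 == s) && (Y w == u)].
Proof.
rewrite (pr_partition (fun w => w i 0)) (eq_bigr _ (fun t _ => pr_masked u t s)).
by rewrite sumr_const mulr_natl.
Qed.

Lemma cond_entropy_masked :
  cond_entropy pmf (fun x => x i 0) Y = ln #|F|%:R.
Proof.
have q0 : 0 < #|F|%:R :> R by rewrite ltr0n (ltn_trans _ (card_finNzRing_gt1 F)).
rewrite /cond_entropy (eq_bigr (fun u => pr pmf [pred w : 'cV[F]_n | Y w == u] * ln (#|F|%:R)^-1)).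
  rewrite -mulr_suml (_ : \sum_u _ = 1) ?mul1r ?lnV ?opprK //.
  by rewrite -pmf_sum /pr [RHS](partition_big Y predT).
move=> u _; rewrite [in RHS](pr_partition (fun w => w i 0)) mulr_suml.
apply: eq_bigr => s _; rewrite (pr_marginal u s) /=; set p := pr _ _.
(* The probability is zero when [u] is not a value of [Y]; otherwise the conditional probability is
   [1 / #|F|]. *)
have [->|p0] := eqVneq p 0; first by rewrite !mul0r.
by rewrite invfM mulrCA divff // mulr1.
Qed.

End Masked.

Lemma pr_coord i s : pr pmf [pred w : 'cV[F]_n | w i 0 == s] = (#|F|%:R)^-1.
Proof.
have q0 : #|F|%:R != 0 :> R by rewrite pnatr_eq0 -lt0n (ltn_trans _ (card_finNzRing_gt1 F)).
apply: (mulfI q0); rewrite divff //.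
(* Under a constant observation every vector is invisible, so the all-ones vector masks each
   coordinate. *)
have z1 : (const_mx 1 : 'cV[F]_n) i 0 != 0 by rewrite mxE oner_eq0.
have := pr_marginal periodic_const (erefl : tt = tt) z1 tt s.
rewrite /pr /= => e; rewrite -[RHS]pmf_sum.
under eq_bigl => w do rewrite -(andbT (_ == s)) -(eqxx tt).
by rewrite -e.
Qed.

Lemma entropy_coord i : entropy pmf (fun x => x i 0) = ln #|F|%:R.
Proof.
have q0 : 0 < #|F|%:R :> R by rewrite ltr0n (ltn_trans _ (card_finNzRing_gt1 F)).
rewrite /entropy; under eq_bigr => s _ do rewrite pr_coord.
by rewrite sumr_const -[X in - X]mulr_natl mulrA divff ?gt_eqF // mul1r lnV ?opprK.
Qed.

(** Each joint event is either empty or equal to the event [Y = u], so every term is zero or has a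
    logarithm of 1. *)
Lemma cond_entropy_determined U (Y : 'cV[F]_n -> U) i :
  (forall x y, Y x = Y y -> x i 0 = y i 0) ->
  cond_entropy pmf (fun x => x i 0) Y = 0.
Proof.
move=> det; rewrite /cond_entropy big1 ?oppr0 // => u _; rewrite big1 // => s _.
case: (pickP [pred w : 'cV[F]_n | (w i 0 == s) && (Y w == u)]) => [w /andP[/eqP ws /eqP wu]|no].
  rewrite (_ : pr pmf [pred w : 'cV[F]_n | _ && _] = pr pmf [pred w : 'cV[F]_n | Y w == u]); last first.
    apply: eq_bigl => v /=; case: (eqVneq (Y v) u) => [vu|_]; last by rewrite andbF.
    by rewrite andbT -ws (det v w) ?eqxx // vu.
  set p := pr _ _.
  have [->|p0] := eqVneq p 0; first by rewrite mul0r.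
  by rewrite divff // ln1 mulr0.
by rewrite {1}/pr big_pred0 ?mul0r.
Qed.

(** There is a dichotomy. A mask gives conditional entropy [ln #|F|]. Without one, two vectors with
    the same observation have an invisible difference, hence agree at [i], and the conditional
    entropy is zero, which is less than [ln #|F|]. *)
Lemma weakly_secureP (A : {set 'I_n}) U (c : 'cV[F]_n -> U) : periodic c ->
  weakly_secure R A c <->
  forall i, i \notin A -> exists x, [/\ c x = c 0,
    forall j, j \in A -> x j 0 = 0 & x i 0 != 0].
Proof.
move=> hc; pose Y x := (c x, restr A x).
have hY : periodic Y by apply: periodic_pair => //; exact: periodic_restr.
have YP x : Y x = Y 0 <-> c x = c 0 /\ forall j, j \in A -> x j 0 = 0.
  split=> [[-> /colP e]|[e eA]]; first split=> // j jA.
    by have := e (enum_rank_in jA j); rewrite !mxE enum_rankK_in.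
  by congr (_, _) => //; apply/colP=> k; rewrite !mxE eA ?enum_valP.
split=> [sec i iA|mask i iA]; last first.
  have [z [z1 z2 z3]] := mask i iA; rewrite entropy_coord.
  by apply: (cond_entropy_masked hY _ z3); apply/YP.
have := sec i iA; rewrite entropy_coord.
case: (pickP [pred x | (Y x == Y 0) && (x i 0 != 0)]) => [x|no].
  by case/andP=> /eqP/YP[? ?] ? _; exists x.
rewrite cond_entropy_determined => [/esym/eqP|x y /hY.2 e].
  by rewrite gt_eqF // ln_gt0 // ltr1n card_finNzRing_gt1.
by have := no (x - y); rewrite /= e eqxx !mxE subr_eq0 => /negbFE/eqP.
Qed.

End Security.

(** * Kernel criteria and length bounds for single-sender codes *)

Definition vanishes (F : finFieldType) (n : nat) (x : 'cV[F]_n) (B : {set 'I_n}) :=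
  forall j, j \in B -> x j 0 = 0.

Section LinearCodes.
Variables (R : realType) (F : finFieldType) (n : nat).
Variables (K : 'I_n -> {set 'I_n}) (A : {set 'I_n}).

Lemma decodableP (U : finType) (c : 'cV[F]_n -> U) : periodic c ->
  decodable K c <->
  forall i x, c x = c 0 -> vanishes x (K i) -> x i 0 = 0.
Proof.
move=> hc; split=> [dec i x cx xK|ker i].
  have [d hd] := dec i; rewrite -hd cx.
  have -> : restr (K i) x = restr (K i) 0.
    by apply/colP=> k; rewrite !mxE xK ?enum_valP.
  by rewrite hd mxE.
(* The decoder guesses any message vector consistent with the observation; its error lies in the
   kernel and vanishes on [K i]. The default 0 is never reached on a genuine observation. *)
exists (fun t r => if [pick y | (c y == t) && (restr (K i) y == r)] is Some y
  then y i 0 else 0) => x.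
case: pickP => [y /andP[/eqP cy /eqP ry]|/(_ x)]; last by rewrite !eqxx.
apply/eqP; have := ker i (y - x) (hc.2 _ _ cy); rewrite !mxE => h.
rewrite -subr_eq0 h // => j jK.
have /colP/(_ (enum_rank_in jK j)) := ry.
by rewrite !mxE enum_rankK_in // => ->; rewrite subrr.
Qed.

Definition ker_decodable l (G : 'M[F]_(l, n)) :=
  forall i x, G *m x = 0 -> vanishes x (K i) -> x i 0 = 0.

Lemma secure_codeP l (G : 'M[F]_(l, n)) : secure_code R K A G <->
  ker_decodable G /\
  forall i, i \notin A ->
    exists x, [/\ G *m x = 0, vanishes x A & x i 0 != 0].
Proof.
have hG := periodic_mulmx G.
by rewrite /secure_code decodableP // weakly_secureP // mulmx0.
Qed.

(** Replacing [G] by a basis of its row space keeps the kernel, hence decodability and security, and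
    yields a code of length [\rank G]. *)
Lemma opt_length_rank l l' (G : 'M[F]_(l', n)) :
  opt_length R F K A l -> secure_code R K A G -> (l <= \rank G)%N.
Proof.
move=> [_ lmin] /secure_codeP[dec mask]; apply: lmin.
exists (row_base G); apply/secure_codeP; split=> [i x gx|i /mask].
  apply: dec; have /submxP[D ->] : (G <= row_base G)%MS by rewrite eq_row_base.
  by rewrite -mulmxA gx mulmx0.
case=> x [gx xA xi]; exists x; split=> //.
have /submxP[D ->] : (row_base G <= G)%MS by rewrite eq_row_base.
by rewrite -mulmxA gx mulmx0.
Qed.

(* The interference [H y] is projected away by the row functionals
   that annihilate the columns of [H]. *)
Lemma opt_length_interference l L p (G : 'M[F]_(L, n)) (H : 'M[F]_(L, p)) :
  opt_length R F K A l -> secure_code R K A G ->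
  (forall i x y, G *m x = H *m y -> vanishes x (K i) -> x i 0 = 0) ->
  (l + \rank H <= L)%N.
Proof.
move=> lopt /secure_codeP[_ mask] dec.
(* [cokermx] works with row vectors, hence the transposes. [W] has rank [L - \rank H], which bounds
   the rank of [W *m G]. *)
pose W := (cokermx H^T)^T.
have : (l <= \rank (W *m G))%N.
  apply: opt_length_rank lopt _; apply/secure_codeP; split=> [i x wx|i /mask].
    have /submxP[D e] : ((G *m x)^T <= H^T)%MS.
      by rewrite submxE -[cokermx _]trmxK -trmx_mul mulmxA wx trmx0.
    by apply: (dec i x D^T); rewrite -[LHS]trmxK e trmx_mul trmxK.
  by case=> x [gx xA xi]; exists x; rewrite -mulmxA gx mulmx0.
have := mxrankM_maxl W G; rewrite mxrank_tr mxrank_coker mxrank_tr => h1 h2.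
by rewrite addnC -leq_subRL ?rank_leq_row // (leq_trans h2).
Qed.

End LinearCodes.

(** * Restriction of a code to an induced subproblem *)

Section Subproblems.
Variables (R : realType) (F : finFieldType) (m : nat).
Variables (K : 'I_m -> {set 'I_m}) (A : {set 'I_m}).
Implicit Types B : {set 'I_m}.

(** Padding by zeros as a matrix, so that [G *m extend B] generates the code induced on [B]; its
    transpose is [restr B]. *)
Definition extend (B : {set 'I_m}) : 'M[F]_(m, #|B|) :=
  \matrix_(j, k) (j == enum_val k)%:R.

Lemma extend_in B (y : 'cV[F]_#|B|) k : (extend B *m y) (enum_val k) 0 = y k 0.
Proof.
rewrite mxE (bigD1 k) //= mxE eqxx mul1r big1 ?addr0 // => j jk.
by rewrite mxE (inj_eq enum_val_inj) eq_sym (negbTE jk) mul0r.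
Qed.

Lemma extend_out B (y : 'cV[F]_#|B|) j : j \notin B -> (extend B *m y) j 0 = 0.
Proof.
move=> jB; rewrite mxE big1 // => k _; rewrite mxE.
by case: eqP jB => [->|_ _]; rewrite ?enum_valP ?mul0r.
Qed.

Lemma restrE B (x : 'cV[F]_m) : restr B x = (extend B)^T *m x.
Proof.
apply/colP=> k; rewrite !mxE (bigD1 (enum_val k)) //= !mxE eqxx mul1r.
by rewrite big1 ?addr0 // => j /negbTE jk; rewrite !mxE jk mul0r.
Qed.

Lemma extend_restr B (x : 'cV[F]_m) j : j \in B ->
  (extend B *m restr B x) j 0 = x j 0.
Proof. by move=> jB; rewrite -(enum_rankK_in jB jB) extend_in mxE. Qed.

Lemma enum_val_ex (B : {set 'I_m}) j : j \in B -> exists k : 'I_#|B|, j = enum_val k.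
Proof. by move=> jB; exists (enum_rank_in jB j); rewrite enum_rankK_in. Qed.

Lemma restr_eq0 (B : {set 'I_m}) (x : 'cV[F]_m) : vanishes x B -> restr B x = 0.
Proof. by move=> xB; apply/colP=> k; rewrite !mxE xB ?enum_valP. Qed.

Lemma vanishes_restr B (D : {set 'I_m}) (x : 'cV[F]_m) :
  vanishes x D -> vanishes (restr B x) (sub_set B D).
Proof. by move=> xD k; rewrite inE mxE; apply: xD. Qed.

Lemma vanishes_extend B (D : {set 'I_m}) (y : 'cV[F]_#|B|) :
  vanishes y (sub_set B D) -> vanishes (extend B *m y) D.
Proof.
move=> yD j jD; have [jB|/extend_out->//] := boolP (j \in B).
by have [k ek] := enum_val_ex jB; rewrite ek extend_in yD // inE -ek.
Qed.

(** Decodability passes to [B] by zero padding. Security does not pass automatically, since a mask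
    may rely on messages outside [B]; hence the assumption that its part on [B] is invisible by
    itself. *)
Lemma secure_sub l (G : 'M[F]_(l, m)) B : ker_decodable K G ->
  (forall i, i \in B -> i \notin A -> exists x,
    [/\ G *m (extend B *m restr B x) = 0, vanishes x A & x i 0 != 0]) ->
  secure_code R (sub_side B K) (sub_set B A) (G *m extend B).
Proof.
move=> dec mask; apply/secure_codeP; split=> [k y gy yK|k].
  rewrite -extend_in; apply: dec; first by rewrite mulmxA.
  exact: vanishes_extend.
rewrite inE => /mask[|x [gx xA xi]]; first exact: enum_valP.
exists (restr B x); rewrite -mulmxA; split=> //; first exact: vanishes_restr.
by rewrite mxE.
Qed.

(** To the receivers in [B] the messages of [B'] are pure interference, spanning a space of
    dimension at least [l']. *)
Lemma opt_length_disjoint L (G : 'M[F]_(L, m)) B B' l l' :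
  [disjoint B & B'] -> (forall i j, i \in B -> j \in B' -> j \notin K i) ->
  ker_decodable K G ->
  opt_length R F (sub_side B K) (sub_set B A) l ->
  secure_code R (sub_side B K) (sub_set B A) (G *m extend B) ->
  opt_length R F (sub_side B' K) (sub_set B' A) l' ->
  secure_code R (sub_side B' K) (sub_set B' A) (G *m extend B') ->
  (l + l' <= L)%N.
Proof.
move=> dBB' noedge dec lopt lsec lopt' lsec'.
have h := opt_length_rank lopt' lsec'.
rewrite (leq_trans (_ : _ <= l + \rank (G *m extend B'))%N) ?leq_add2l //.
apply: opt_length_interference lopt lsec _ => k x y e xK.
have kB : enum_val k \notin B' by rewrite (disjointFr dBB') // enum_valP.
(* This difference is in the kernel of [G], vanishes on the side-information of the receiver, and
   has the entry [x k 0] at the demanded message. *)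
have := dec (enum_val k) (extend B *m x - extend B' *m y).
rewrite mulmxBr !mulmxA e subrr mxE extend_in mxE extend_out // subr0; apply=> //.
move=> j jK; have jB' : j \notin B'.
  by apply/negP=> /(noedge _ _ (enum_valP k)); rewrite jK.
by rewrite mxE (vanishes_extend xK jK) add0r mxE extend_out ?oppr0.
Qed.

End Subproblems.

(** * Two-sender codes as stacked matrices, and the lower bounds *)

Section TwoSenders.
Variables (R : realType) (F : finFieldType) (m : nat).
Variables (K : 'I_m -> {set 'I_m}) (M1 M2 A : {set 'I_m}).

(** For a linear [f] this is dependence on [M] only, stated through the kernel so that [f] keeps all
    [m] messages as its input. *)
Definition supported (M : {set 'I_m}) l (f : 'cV[F]_m -> 'cV[F]_l) :=
  forall x, vanishes x M -> f x = 0.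

Lemma mulmx_of_linear l (f : 'cV[F]_m -> 'cV[F]_l) : linear f ->
  exists G : 'M[F]_(l, m), f =1 mulmx G.
Proof.
move=> lf.
pose f' : {linear 'cV[F]_m -> 'cV[F]_l} :=
  HB.pack f (GRing.isLinear.Build _ _ _ _ f lf).
have fZ a x : f (a *: x) = a *: f x by rewrite -[f]/(f' : _ -> _) linearZ.
exists (\matrix_(i, j) f (delta_mx j 0) i 0) => x.
rewrite -[f]/(f' : _ -> _) {1}[x]matrix_sum_delta linear_sum /=.
apply/colP=> i; rewrite summxE !mxE; apply: eq_bigr => j _.
by rewrite big_ord1 fZ !mxE mulrC.
Qed.

Lemma linear_in_mulmx (M : {set 'I_m}) l (G : 'M[F]_(l, m)) f :
  f =1 mulmx G -> supported M (mulmx G) -> linear_in M f.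
Proof.
move=> fG sG; exists (G *m extend F M) => x.
rewrite fG -mulmxA; apply/eqP; rewrite -subr_eq0 -mulmxBr sG // => j jM.
by rewrite mxE [X in _ + X]mxE extend_restr // subrr.
Qed.

Lemma mulmx_of_linear_in (M : {set 'I_m}) l (f : 'cV[F]_m -> 'cV[F]_l) :
  linear_in M f ->
  exists2 G : 'M[F]_(l, m), f =1 mulmx G & supported M (mulmx G).
Proof.
case=> G fG; exists (G *m (extend F M)^T) => [x|x xM].
  by rewrite fG restrE mulmxA.
by rewrite -mulmxA -restrE restr_eq0 ?mulmx0.
Qed.

(** The pair of codewords and the stacked codeword have the same kernel, so the single-sender
    criteria apply to two-sender codes. *)
Lemma secure_code2_col_mx (c : code2 F m) (G1 : 'M[F]_(len1 c, m))
    (G2 : 'M[F]_(len2 c, m)) :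
  @cw1 F m c =1 mulmx G1 -> @cw2 F m c =1 mulmx G2 ->
  supported M1 (mulmx G1) -> supported M2 (mulmx G2) ->
  secure_code2 R K M1 M2 A c <-> secure_code R K A (col_mx G1 G2).
Proof.
move=> e1 e2 s1 s2.
have per : periodic (fun x => (cw1 c x, cw2 c x)).
  have [a1 b1] := periodic_pair (periodic_mulmx G1) (periodic_mulmx G2).
  by split=> [a x y|x y]; rewrite !e1 !e2; [exact: a1 | exact: b1].
have kerE x : (cw1 c x, cw2 c x) = (cw1 c 0, cw2 c 0) <-> col_mx G1 G2 *m x = 0.
  rewrite !e1 !e2 mul_col_mx !mulmx0; split=> [[-> ->]|]; first by rewrite col_mx0.
  by move/eqP; rewrite col_mx_eq0 => /andP[/eqP-> /eqP->].
rewrite secure_codeP; split=> [[_ _ /decodableP dec /weakly_secureP sec]|[dec sec]].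
  split=> [i x gx xK|i iA]; first by apply: dec => //; apply/kerE.
  by have [x [gx xA xi]] := sec per i iA; exists x; split=> //; apply/kerE.
split; [exact: linear_in_mulmx e1 s1|exact: linear_in_mulmx e2 s2| |].
  by apply/decodableP => // i x /kerE gx xK; apply: dec xK.
apply/weakly_secureP => // i /sec[x [gx xA xi]]; exists x; split=> //.
exact/kerE.
Qed.

Local Notation P := (part M1 M2).

Section Converse.
Variable l : senders -> nat.
Hypothesis hl : forall T, opt_length R F (sub_side (P T) K) (sub_set (P T) A) (l T).
Hypothesis hA12 : P S12 \subset A.
Variables (L1 L2 : nat) (G1 : 'M[F]_(L1, m)) (G2 : 'M[F]_(L2, m)).
Hypotheses (s1 : supported M1 (mulmx G1)) (s2 : supported M2 (mulmx G2)).
Hypothesis hG : secure_code R K A (col_mx G1 G2).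

(** Within [M] the two inputs can differ only on the common messages, where [x] is zero because the
    eavesdropper knows them. *)
Lemma mulmx_restr_part (M M' : {set 'I_m}) L (G : 'M[F]_(L, m)) x :
  M :&: M' \subset A -> supported M (mulmx G) -> vanishes x A ->
  G *m (extend F (M :\: M') *m restr (M :\: M') x) = G *m x.
Proof.
move=> sMA sG xA; apply/eqP; rewrite -subr_eq0 -mulmxBr sG // => j jM.
rewrite mxE [X in _ + X]mxE; have [jM'|jM'] := boolP (j \in M').
  rewrite extend_out ?inE ?jM' // xA ?subrr //.
  by apply: (subsetP sMA); rewrite inE jM.
by rewrite extend_restr ?subrr // inE jM' jM.
Qed.

Lemma mulmx_extend_part (M M' : {set 'I_m}) L (G : 'M[F]_(L, m)) :
  supported M (mulmx G) -> G *m extend F (M' :\: M) = 0.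
Proof.
move=> sG; apply/matrixP=> i k; have /colP/(_ i) : col k (G *m extend F (M' :\: M)) = 0.
  rewrite colE -mulmxA sG // => j jM; apply: extend_out.
  by rewrite inE jM.
by rewrite mxE => ->; rewrite !mxE.
Qed.

(** The private part of a mask is invisible in both codewords: its owner sees it as the whole mask,
    and the other sender does not have these messages. In [P S12] nothing has to be hidden. *)
Lemma secure_part T :
  secure_code R (sub_side (P T) K) (sub_set (P T) A) (col_mx G1 G2 *m extend F (P T)).
Proof.
have /secure_codeP[dec mask] := hG.
apply: secure_sub => // i iT iA.
have [x [/eqP gx xA xi]] := mask i iA; exists x; split=> //.
move: gx; rewrite !mul_col_mx col_mx_eq0 => /andP[/eqP g1 /eqP g2].
apply/eqP; rewrite col_mx_eq0; case: T iT => /= iT.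
- by rewrite mulmx_restr_part // g1 mulmxA mulmx_extend_part // mul0mx !eqxx.
- rewrite (mulmx_restr_part _ s2) // 1?setIC // g2.
  by rewrite mulmxA mulmx_extend_part // mul0mx !eqxx.
- by move: iA; rewrite (subsetP hA12).
Qed.

Lemma opt_length_le T : (l T <= L1 + L2)%N.
Proof.
by apply: leq_trans (opt_length_rank (hl T) (secure_part T)) (rank_leq_row _).
Qed.

(** On private messages the block of the other sender is zero, so the whole rank comes from the
    owner's block. *)
Lemma opt_length_private : (l S1 <= L1)%N /\ (l S2 <= L2)%N.
Proof.
split.
  have := opt_length_rank (hl S1) (secure_part S1).
  rewrite /= mul_col_mx (mulmx_extend_part M1 s2) => h; apply: leq_trans h _.
  by rewrite -addsmxE addsmx0 rank_leq_row.
have := opt_length_rank (hl S2) (secure_part S2).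
rewrite /= mul_col_mx (mulmx_extend_part M2 s1) => h; apply: leq_trans h _.
by rewrite -addsmxE adds0mx rank_leq_row.
Qed.

(** Contrapositive of [opt_length_disjoint] for the parts [P T] and [P T']. *)
Lemma interaction_of_lt T T' : T <> T' -> (L1 + L2 < l T + l T')%N ->
  interaction K M1 M2 T T'.
Proof.
move=> neTT' lt; have /secure_codeP[dec _] := hG.
case: (boolP [exists i, exists j, [&& i \in P T, j \in P T' & j \in K i]]).
  by case/existsP=> i /existsP[j /and3P[? ? ?]]; exists i, j.
move=> noedge; move: lt; rewrite ltnNge => /negP[].
apply: (opt_length_disjoint _ _ dec (hl T) (secure_part T) (hl T') (secure_part T')).
  rewrite -setI_eq0; apply/eqP/setP=> j.
  by case: T T' neTT' {noedge} => [] [] // _; rewrite !inE;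
    case: (j \in M1); case: (j \in M2).
move=> i j iT jT'; apply: contra noedge => jK.
by apply/existsP; exists i; apply/existsP; exists j; rewrite iT jT'.
Qed.

End Converse.

Lemma opt_length2_bounds l lstar :
  (forall T, opt_length R F (sub_side (P T) K) (sub_set (P T) A) (l T)) ->
  P S12 \subset A -> opt_length2 R F K M1 M2 A lstar ->
  [/\ (l S1 + l S2 <= lstar)%N, (l S12 <= lstar)%N &
    forall T T', T <> T' -> (lstar < l T + l T')%N -> interaction K M1 M2 T T'].
Proof.
move=> hl hA12 [[c [hc <-]] _]; have [lin1 lin2 _ _] := hc.
have [G1 e1 s1] := mulmx_of_linear_in lin1.
have [G2 e2 s2] := mulmx_of_linear_in lin2.
have {}hc := (secure_code2_col_mx e1 e2 s1 s2).1 hc.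
split=> [||T T' neTT']; last exact: (interaction_of_lt hl hA12 s1 s2 hc).
  by have [h1 h2] := opt_length_private hl hA12 s1 s2 hc; apply: leq_add.
exact: (opt_length_le hl hA12 s1 s2 hc).
Qed.

End TwoSenders.

(** * Symbol-wise algebra of padded sums and slices *)

Section Symbols.
Variable F : finFieldType.

Lemma sym_ord l (u : 'cV[F]_l) (k : 'I_l) : sym u k = u k 0.
Proof. by rewrite /sym valK. Qed.

Lemma sym_out l (u : 'cV[F]_l) k : (l <= k)%N -> sym u k = 0.
Proof. by move=> lk; rewrite /sym insubN // -leqNgt. Qed.

Lemma sym0 l k : sym (0 : 'cV[F]_l) k = 0.
Proof. by rewrite /sym; case: insub => [i|] //; rewrite mxE. Qed.

Lemma sym_linear l a (u v : 'cV[F]_l) k : sym (a *: u + v) k = a * sym u k + sym v k.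
Proof. by rewrite /sym; case: insub => [i|]; rewrite ?mxE // mulr0 addr0. Qed.

Lemma sym_eq0 l (u : 'cV[F]_l) : (forall k, (k < l)%N -> sym u k = 0) -> u = 0.
Proof. by move=> u0; apply/colP=> k; rewrite -sym_ord u0 // mxE. Qed.

Lemma sym_addcw a b (u : 'cV[F]_a) (v : 'cV[F]_b) k :
  sym (addcw u v) k = sym u k + sym v k.
Proof.
have [kab|kab] := ltnP k (maxn a b).
  by rewrite -[k]/(val (Ordinal kab)) sym_ord mxE.
by move: (kab); rewrite geq_max => /andP[? ?]; rewrite !sym_out ?addr0.
Qed.

Lemma sym_slice l (u : 'cV[F]_l) a b k :
  sym (slice u a b) k = if (k < b.+1 - a)%N then sym u (a.-1 + k) else 0.
Proof.
case: ltnP => kab; last by rewrite sym_out.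
by rewrite -[k]/(val (Ordinal kab)) sym_ord mxE.
Qed.

Lemma addcw_linear m a b (f : 'cV[F]_m -> 'cV[F]_a) (g : 'cV[F]_m -> 'cV[F]_b) :
  linear f -> linear g -> linear (fun x => addcw (f x) (g x)).
Proof.
move=> lf lg t x y; apply/colP=> k; rewrite !mxE lf lg !sym_linear.
by rewrite mulrDr addrACA.
Qed.

Lemma slice_linear m l (f : 'cV[F]_m -> 'cV[F]_l) a b :
  linear f -> linear (fun x => slice (f x) a b).
Proof. by move=> lf t x y; apply/colP=> k; rewrite !mxE lf sym_linear. Qed.

Lemma col_mx_linear m a b (f : 'cV[F]_m -> 'cV[F]_a) (g : 'cV[F]_m -> 'cV[F]_b) :
  linear f -> linear g -> linear (fun x => col_mx (f x) (g x)).
Proof. by move=> lf lg t x y; rewrite lf lg scale_col_mx add_col_mx. Qed.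

Lemma addcw0 a b : addcw (0 : 'cV[F]_a) (0 : 'cV[F]_b) = 0.
Proof. by apply/colP=> k; rewrite !mxE !sym0 addr0. Qed.

Lemma slice0 l a b : slice (0 : 'cV[F]_l) a b = 0.
Proof. by apply/colP=> k; rewrite !mxE sym0. Qed.

Lemma addcw_eq0 a b (u : 'cV[F]_a) (v : 'cV[F]_b) :
  addcw u v = 0 -> forall k, sym u k + sym v k = 0.
Proof. by move=> e k; rewrite -sym_addcw e sym0. Qed.

(** The linear form of cancelling a known codeword; nothing is lost, as the padded sum covers every
    symbol of [u]. *)
Lemma addcw_eq0l a b (u : 'cV[F]_a) (v : 'cV[F]_b) : addcw u v = 0 -> v = 0 -> u = 0.
Proof.
move=> /addcw_eq0 e v0; apply: sym_eq0 => k _.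
by have := e k; rewrite v0 sym0 addr0.
Qed.

Lemma addcw_eq0r a b (u : 'cV[F]_a) (v : 'cV[F]_b) : addcw u v = 0 -> u = 0 -> v = 0.
Proof.
move=> /addcw_eq0 e v0; apply: sym_eq0 => k _.
by have := e k; rewrite v0 sym0 add0r.
Qed.

Lemma slices_eq0 l (u : 'cV[F]_l) n :
  slice u 1 n = 0 -> slice u n.+1 l = 0 -> u = 0.
Proof.
move=> e1 e2; apply: sym_eq0 => k kl; have [kn|nk] := ltnP k n.
  by have := congr1 (fun v => sym v k) e1; rewrite sym_slice sym0 subn1 kn.
(* The slice from the 1-based position [n.+1] starts at the 0-based coordinate [n]. *)
have := congr1 (fun v => sym v (k - n)) e2; rewrite sym_slice sym0 /= subnKC //.
by rewrite subSS ltn_sub2r // (leq_ltn_trans nk).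
Qed.

End Symbols.

(** * Decodability and security of the constructed codes *)

Section Achievability.
Variables (R : realType) (F : finFieldType) (m : nat).
Variables (K : 'I_m -> {set 'I_m}) (M1 M2 A : {set 'I_m}).
Hypotheses (hM : M1 :|: M2 = [set: 'I_m]).
Local Notation P := (part M1 M2).
Variables (l : senders -> nat) (C : forall T, 'M[F]_(l T, #|P T|)).
Hypothesis hC : forall T,
  secure_code R (sub_side (P T) K) (sub_set (P T) A) (C T).

Definition codeword T (x : 'cV[F]_m) : 'cV[F]_(l T) := C T *m restr (P T) x.

Lemma codeword_linear T : linear (codeword T).
Proof. by move=> a x y; rewrite /codeword !restrE !mulmxDr -!scalemxAr. Qed.

Lemma codeword_eq0 T x : vanishes x (P T) -> codeword T x = 0.
Proof. by move=> xT; rewrite /codeword restr_eq0 ?mulmx0. Qed.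

Lemma part_cover i : exists T, i \in P T.
Proof.
have : i \in M1 :|: M2 by rewrite hM inE.
rewrite inE; case i1: (i \in M1); case i2: (i \in M2) => // _.
- by exists S12; rewrite !inE i1 i2.
- by exists S1; rewrite !inE i1 i2.
- by exists S2; rewrite !inE i1 i2.
Qed.

Lemma part_inj i T T' : i \in P T -> i \in P T' -> T = T'.
Proof.
by case: T T' => [] [] //; rewrite !inE; case: (i \in M1); case: (i \in M2).
Qed.

(** The parts are disjoint, so a padded vector is zero on all parts other than [P T]; masks of [C T]
    thus hide in all three codewords. *)
Lemma codeword_extend T (y : 'cV[F]_#|P T|) : C T *m y = 0 ->
  forall T', codeword T' (extend F (P T) *m y) = 0.
Proof.
move=> cy T'; have [i /andP[iT iT']|no] := pickP [pred i | (i \in P T) && (i \in P T')].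
  rewrite -(part_inj iT iT') /codeword [restr _ _](_ : _ = y) //.
  by apply/colP=> k; rewrite mxE extend_in.
apply: codeword_eq0 => j jT'; apply: extend_out; have := no j.
by rewrite /= jT' andbT => ->.
Qed.

(** Reduction to whole codewords. Masks of the [C T] survive when the transmission depends on the
    three codewords only. A receiver in [P T] knows each part that [T] fully reaches, and once it
    has the codeword of [T] the decoder of [C T] finishes. *)
Lemma secure_code2_constructed (c : code2 F m) :
  linear (cw1 c) -> linear (cw2 c) ->
  supported M1 (@cw1 F m c) -> supported M2 (@cw2 F m c) ->
  (forall x, (forall T, codeword T x = 0) -> cw1 c x = 0 /\ cw2 c x = 0) ->
  (forall x T, cw1 c x = 0 -> cw2 c x = 0 ->
    (forall T', fully_participated K M1 M2 T T' -> codeword T' x = 0) ->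
    codeword T x = 0) ->
  secure_code2 R K M1 M2 A c.
Proof.
move=> lin1 lin2 s1 s2 mask dec.
have [G1 e1] := mulmx_of_linear lin1; have [G2 e2] := mulmx_of_linear lin2.
have t1 : supported M1 (mulmx G1) by move=> x xM; rewrite -e1 s1.
have t2 : supported M2 (mulmx G2) by move=> x xM; rewrite -e2 s2.
apply/(secure_code2_col_mx _ _ _ e1 e2 t1 t2); apply/secure_codeP; split.
  move=> i x /eqP; rewrite mul_col_mx col_mx_eq0 -e1 -e2 => /andP[/eqP x1 /eqP x2] xK.
  have [T iT] := part_cover i; have [k ik] := enum_val_ex iT.
  have /secure_codeP[decT _] := hC T.
  have -> : x i 0 = restr (P T) x k 0 by rewrite mxE -ik.
  apply: decT; last by apply: vanishes_restr; rewrite -ik.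
  apply: dec => // T' full; apply: codeword_eq0 => j jT'.
  by apply: xK; apply: full iT jT'.
move=> i iA; have [T iT] := part_cover i; have [k ik] := enum_val_ex iT.
have /secure_codeP[_ /(_ k)] := hC T; rewrite inE -ik => /(_ iA)[y [cy yA yk]].
exists (extend F (P T) *m y); split; last by rewrite ik extend_in.
  have [c1 c2] := mask _ (codeword_extend cy).
  by rewrite mul_col_mx -e1 -e2 c1 c2 col_mx0.
exact: vanishes_extend.
Qed.

(** A cycle of length 3 passes through all three vertices, so each has an outgoing edge. *)
Lemma case_E_out T : case_E K M1 M2 ->
  exists2 T', T' <> T & fully_participated K M1 M2 T T'.
Proof.
case=> full [T1 [T2 [T3 [n12 n23 n13 [[_ e1] [_ e2] [_ e3]]]]]] _ _.
by case: T1 T2 T3 T n12 n23 n13 e1 e2 e3 => [] [] [] [] // _ _ _ e1 e2 e3;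
  (by exists S1 => //; apply: full)
  || (by exists S2 => //; apply: full) || (by exists S12 => //; apply: full).
Qed.

(** [v] is the piece of the common codeword that both senders add. Whichever other codeword the
    receiver knows, cancelling it reveals [v], and [v] then reveals its own codeword. *)
Lemma case_E_decode n (v : 'cV[F]_n) x T : case_E K M1 M2 ->
  addcw (codeword S1 x) v = 0 -> addcw (codeword S2 x) v = 0 ->
  (codeword S12 x = 0 <-> v = 0) ->
  (forall T', fully_participated K M1 M2 T T' -> codeword T' x = 0) ->
  codeword T x = 0.
Proof.
move=> /(case_E_out T)[T' _ full] e1 e2 e12 /(_ T' full) z.
have v0 : v = 0 by case: T' {full} z => [/(addcw_eq0r e1)|/(addcw_eq0r e2)|/e12].
by case: T {T' full z}; [apply: addcw_eq0l e1 _|apply: addcw_eq0l e2 _|apply/e12].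
Qed.

Lemma slices_eq0_iff n (u : 'cV[F]_n) k :
  slice u k.+1 n = 0 -> u = 0 <-> slice u 1 k = 0.
Proof. by move=> e; split=> [->|/slices_eq0]; [exact: slice0|apply]. Qed.

Lemma secure_constructed c : constructed K C c -> secure_code2 R K M1 M2 A c.
Proof.
have lin := codeword_linear.
have v1 x : vanishes x M1 -> codeword S1 x = 0 /\ codeword S12 x = 0.
  by move=> xM; split; apply: codeword_eq0 => j; rewrite !inE => /andP[? ?]; apply: xM.
have v2 x : vanishes x M2 -> codeword S2 x = 0 /\ codeword S12 x = 0.
  by move=> xM; split; apply: codeword_eq0 => j; rewrite !inE => /andP[? ?]; apply: xM.
(* For each sender, [f] is full participation towards [S12] and [g] is full participation back from
   [S12]. *)
case=> [[[_ f1 _ g1] [_ f2 _ g2]] _|[[_ f1 _ g1] [_ f2 _ _]] _|[[_ f1 _ _] [_ f2 _ g2]] _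
  |[[_ f1 _ g1] _]|[[_ f2 _ g2] _]|hE _|hE _|hE _|hE _|hE _ _];
  apply: secure_code2_constructed => /=.
all: try by do ?[apply: lin | apply: addcw_linear | apply: slice_linear | apply: col_mx_linear].
all: try by [move=> x /v1[e1 e12]; rewrite -?/(codeword _ _) ?e1 ?e12 ?slice0 ?addcw0 ?col_mx0|
  move=> x /v2[e2 e12]; rewrite -?/(codeword _ _) ?e2 ?e12 ?slice0 ?addcw0 ?col_mx0].
all: try by move=> x e; rewrite -?/(codeword _ _) !e ?slice0 ?addcw0 ?col_mx0.
(* Linearity, support and masks are settled; one decoding goal remains per construction. *)
all: move=> x T.
all: rewrite -/(codeword S1 x) -/(codeword S2 x) -?/(codeword S12 x).
- move=> e1 e2; case: T => z.
  + by apply: addcw_eq0l e1 _; rewrite (z S12) ?slice0.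
  + by apply: addcw_eq0l e2 _; rewrite (z S12) ?slice0.
  (* Receivers of common messages know both private codewords and collect one slice from each
     sender. *)
  + by apply: (slices_eq0 (addcw_eq0r e1 (z S1 g1)) (addcw_eq0r e2 (z S2 g2))).
- move=> e1 e2; case: T => // z.
  + exact: addcw_eq0l e1 (z S12 f1).
  + exact: addcw_eq0r e1 (z S1 g1).
- move=> e1 e2; case: T => // z.
  + exact: addcw_eq0l e2 (z S12 f2).
  + exact: addcw_eq0r e2 (z S2 g2).
- move=> e1 e2; case: T => // z.
  + exact: addcw_eq0l e1 (z S12 f1).
  + exact: addcw_eq0r e1 (z S1 g1).
- move=> e1 e2; case: T => // z.
  + exact: addcw_eq0l e2 (z S12 f2).
  + exact: addcw_eq0r e2 (z S2 g2).
- move=> /eqP; rewrite col_mx_eq0 => /andP[/eqP e1 /eqP e12] e2.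
  exact: case_E_decode hE e1 e2 (slices_eq0_iff e12).
- move=> e1 /eqP; rewrite col_mx_eq0 => /andP[/eqP e2 /eqP e12].
  exact: case_E_decode hE e1 e2 (slices_eq0_iff e12).
- move=> /eqP; rewrite col_mx_eq0 => /andP[/eqP e1 /eqP e12] e2.
  exact: case_E_decode hE e1 e2 (slices_eq0_iff e12).
- move=> e1 /eqP; rewrite col_mx_eq0 => /andP[/eqP e2 /eqP e12].
  exact: case_E_decode hE e1 e2 (slices_eq0_iff e12).
- by move=> e1 e2; apply: case_E_decode hE e1 e2 _.
Qed.

End Achievability.

(** * Length of the constructed codes *)

Lemma length_constructed (F : finFieldType) (m : nat) (K : 'I_m -> {set 'I_m})
    (M1 M2 : {set 'I_m}) (l : senders -> nat)
    (C : forall T, 'M[F]_(l T, #|part M1 M2 T|)) (c : code2 F m) :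
  constructed K C c -> (l S12 <= l S1 + l S2)%N ->
  (forall T T', T <> T' -> (l S1 + l S2 < l T + l T')%N ->
    interaction K M1 M2 T T') ->
  length2 c = (l S1 + l S2)%N.
Proof.
move=> hc l12 int.
(* If [l S12] exceeded [l S1], then [l S2 + l S12] would exceed [l S1 + l S2] and force both
   interactions between [S2] and [S12]. *)
have no2 : ~ (interaction K M1 M2 S2 S12 /\ interaction K M1 M2 S12 S2) ->
    (l S12 <= l S1)%N.
  move=> no; rewrite leqNgt; apply/negP=> lt.
  by apply: no; split; apply: int => //; lia.
have no1 : ~ (interaction K M1 M2 S1 S12 /\ interaction K M1 M2 S12 S1) ->
    (l S12 <= l S2)%N.
  move=> no; rewrite leqNgt; apply/negP=> lt.
  by apply: no; split; apply: int => //; lia.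
have noE : case_E K M1 M2 -> (l S12 <= l S1)%N /\ (l S12 <= l S2)%N.
  by case=> _ _ n1 n2; split; [apply: no2|apply: no1] => -[? ?];
    [apply: n2|apply: n1].
(* In the first construction the second slice has length [l S12 - l S1], at most [l S2]. In case E
   the leftover slice is empty. *)
case: hc => [_ _|_ ?|_ ?|[_ /no2 ?]|[_ /no1 ?]|/noE[? ?] ?|/noE[? ?] ?
  |/noE[? ?] ?|/noE[? ?] ?|/noE[? ?] _ _]; rewrite /length2 /=; lia.
Qed.

Theorem theorem3 (R : realType) (F : finFieldType) (m : nat)
    (K : 'I_m -> {set 'I_m}) (M1 M2 A : {set 'I_m})
    (hK : forall i : 'I_m, i \notin K i)
    (hM : M1 :|: M2 = [set: 'I_m])
    (hA : A \proper [set: 'I_m])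
    (l : senders -> nat)
    (hl : forall T : senders,
        opt_length R F (sub_side (part M1 M2 T) K) (sub_set (part M1 M2 T) A) (l T))
    (C : forall T : senders, 'M[F]_(l T, #|part M1 M2 T|))
    (hC : forall T : senders,
        secure_code R (sub_side (part M1 M2 T) K) (sub_set (part M1 M2 T) A) (C T))
    (c : code2 F m)
    (hc : constructed K C c)
    (hA12 : part M1 M2 S12 \subset A)
    (lstar : nat)
    (hlstar : opt_length2 R F K M1 M2 A lstar)
    (hle : (lstar <= l S1 + l S2)%N) :
  secure_code2 R K M1 M2 A c /\ length2 c = lstar.
Proof.
have [ge12 ge3 int] := opt_length2_bounds hl hA12 hlstar.
have elstar : lstar = (l S1 + l S2)%N by apply/eqP; rewrite eqn_leq hle ge12.
split; first exact: (secure_constructed hM hC hc).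
by rewrite elstar in ge3 int *; exact: (length_constructed hc).
Qed.
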